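(* Let $t>2$ be an integer, let $k\geq 3$ be an odd integer, and let $G=D(t-1,t)$. Then $\mathrm{rl}_k(G)\leq \frac t2 k^2+k-\frac{t+2}{2}$.
   Context: For a finite set $D=\{d_1<\dots<d_m\}$ of positive integers, the distance graph $D(d_1,\dots,d_m)$ has vertex set $\mathbb{Z}$, two distinct integers $i,j$ being adjacent iff $|i-j|\in D$. For a connected graph $G$ with graph distance $d(\cdot,\cdot)$ and an integer $k\ge 1$, a radio $k$-labeling of $G$ is a map $c:V(G)\to\mathbb{Z}_{\ge 0}$ such that $|c(u)-c(v)|\geq k+1-d(u,v)$ for all distinct vertices $u,v$. Its span is $\max\{c(x)-c(y): x,y\in V(G)\}$ (a supremum for infinite graphs), and the radio $k$-labeling number $\mathrm{rl}_k(G)$ is the minimum span over all radio $k$-labelings of $G$. *)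

(* Defs.v *)
From mathcomp Require Import all_boot all_order all_algebra.

Set Implicit Arguments.
Unset Strict Implicit.
Unset Printing Implicit Defensive.

Import Order.TTheory GRing.Theory Num.Theory.
Local Open Scope ring_scope.

(* The finite set D is given by the list of its elements. *)
Definition distance_graph (D : seq nat) : rel int :=
  [rel i j | (i != j) && (`|i - j|%N \in D)].

Definition is_walk (V : eqType) (e : rel V) (u v : V) (p : seq V) : Prop :=
  path e u p /\ last u p = v.

(* Graph distance as a functional relation: it is total exactly when the graph
   is connected, as D(t-1, t) is. *)
Definition is_gdist (V : eqType) (e : rel V) (u v : V) (d : nat) : Prop :=
  (exists p, is_walk e u v p /\ size p = d) /\
  (forall p, is_walk e u v p -> (d <= size p)%N).

(* The required separation is compared in int, so that k + 1 - d is not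
   truncated. *)
Definition radio_labeling (V : eqType) (e : rel V) (k : nat) (c : V -> nat) :
  Prop :=
  forall (u v : V) (d : nat), u <> v -> is_gdist e u v d ->
    k%:Z + 1 - d%:Z <= `|(c u)%:Z - (c v)%:Z|.

(* A supremum of integers that is finite is attained; a labeling whose
   supremum is infinite has no span in nat and cannot realize the minimum. *)
Definition is_span (V : Type) (c : V -> nat) (s : nat) : Prop :=
  (forall x y, (c x)%:Z - (c y)%:Z <= s%:Z) /\
  (exists x y, (c x)%:Z - (c y)%:Z = s%:Z).

(* "rl_k(e) is finite and equal to n": n is the minimum of the spans. *)
Definition is_rl (V : eqType) (e : rel V) (k n : nat) : Prop :=
  (exists c, radio_labeling e k c /\ is_span c n) /\
  (forall c s, radio_labeling e k c -> is_span c s -> (n <= s)%N).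

(* Main.v *)
Require Import Defs.
From mathcomp Require Import all_boot all_order all_algebra.
From mathcomp Require Import zify lra.
From Stdlib Require Import Classical.

Set Implicit Arguments.
Unset Strict Implicit.
Unset Printing Implicit Defensive.

Import Order.TTheory GRing.Theory Num.Theory.
Local Open Scope ring_scope.

(* Write k = 2m + 1 and N = (k + 1) t + 3, an odd number. The labeling
   c(x) = m (2x mod N) has span m (N - 1), which is exactly the claimed bound.
   It lists the residues modulo N in the order 0, g, 2g, ... up to sign, with
   g = (m + 1) t + 1 and label increments m: consecutive vertices differ by
   more than (m + 1) t, hence are at distance at least m + 2, and vertices two
   steps apart are congruent to +1 or -1 modulo N, hence not adjacent. *)

(** Well-ordering for an arbitrary, possibly undecidable [P], hence the classical case split. *)
Lemma ex_least_nat (P : nat -> Prop) (s : nat) :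
  P s -> exists n, [/\ P n, (n <= s)%N & forall i, P i -> (n <= i)%N].
Proof.
elim/ltn_ind: s => s IH Ps.
have [[i [Pi lt_is]]|noP] := classic (exists i, P i /\ (i < s)%N).
  have [n [Pn le_ni minP]] := IH i lt_is Pi.
  by exists n; split=> //; apply: leq_trans le_ni (ltnW lt_is).
exists s; split=> // i Pi; rewrite leqNgt; apply/negP => lt_is.
by apply: noP; exists i.
Qed.

(** One labeling of finite span makes the set of spans nonempty, so its minimum exists; an upper
    bound thus reduces to a construction. *)
Lemma is_rl_le (V : eqType) (e : rel V) (k s : nat) (c : V -> nat) :
  radio_labeling e k c -> is_span c s -> exists n, is_rl e k n /\ (n <= s)%N.
Proof.
move=> cP sP.
have [|n [exc le_ns minn]] :=
  @ex_least_nat (fun n => exists c', radio_labeling e k c' /\ is_span c' n) s.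
  by exists c.
by exists n; split=> //; split=> // c' s' c'P s'P; apply: minn; exists c'.
Qed.

(** Each edge moves by at most [b]; this is the source of all large lower bounds on distances
    below. *)
Lemma distance_graph_walk_le (D : seq nat) (b : nat) (p : seq int) (u v : int) :
  {in D, forall x, (x <= b)%N} -> is_walk (distance_graph D) u v p ->
  (`|u - v| <= size p * b)%N.
Proof.
move=> Db; elim: p u => [|w p IH] u [] /= => [_ <-|/andP[/andP[_ uwD] wp] lastp].
  by rewrite subrr.
have := Db _ uwD; have := IH w (conj wp lastp); lia.
Qed.

Lemma distance_graph_gdist_le (D : seq nat) (b d : nat) (u v : int) :
  {in D, forall x, (x <= b)%N} -> is_gdist (distance_graph D) u v d ->
  (`|u - v| <= d * b)%N.
Proof. by move=> Db [[p [pP <-]] _]; apply: distance_graph_walk_le pP. Qed.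

Lemma gdist_gt0 (V : eqType) (e : rel V) (u v : V) (d : nat) :
  u <> v -> is_gdist e u v d -> (0 < d)%N.
Proof. by move=> neq_uv [[[|w p] [[_ /= uv] <-]] _]. Qed.

Lemma gdist1 (V : eqType) (e : rel V) (u v : V) : is_gdist e u v 1 -> e u v.
Proof.
by move=> [[[|w [|? ?]] [[ep <-] //= _]] _]; case/andP: ep.
Qed.

Definition label_period (t m : nat) : nat := (2 * (m.+1 * t) + 3)%N.

Definition mod_label (t m : nat) (x : int) : nat :=
  (`|(2 * x %% (label_period t m)%:Z)%Z| * m)%N.

Lemma mod_label_span (t m : nat) :
  is_span (mod_label t m) ((label_period t m).-1 * m).
Proof.
pose N := label_period t m.
have N_gt0 : 0 < N%:Z by rewrite /N /label_period; lia.
have ub x : (mod_label t m x <= N.-1 * m)%N.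
  rewrite leq_mul2r; apply/orP; right.
  have := modz_ge0 (2 * x) (lt0r_neq0 N_gt0).
  by have := ltz_pmod (2 * x) N_gt0; rewrite /N; lia.
split=> [x y|]; first by have := ub x; lia.
(* Twice this witness is N - 1, the largest residue. *)
exists (m.+1 * t + 1)%N%:Z, 0; rewrite /mod_label mulr0 mod0z mul0n subr0.
by rewrite modz_small /label_period; lia.
Qed.

Lemma mod_label_radio (t m : nat) : (2 < t)%N -> (0 < m)%N ->
  radio_labeling (distance_graph [:: (t - 1)%N; t]) (2 * m + 1) (mod_label t m).
Proof.
move=> t_gt2 m_gt0 u v d neq_uv dP.
have d_gt0 := gdist_gt0 neq_uv dP.
have le_d : (`|u - v| <= d * t)%N.
  by apply: distance_graph_gdist_le dP => x; rewrite !inE => /orP[]/eqP->; lia.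
have d_neq1 : (d == 1)%N -> (`|u - v| == t - 1)%N || (`|u - v| == t)%N.
  by move=> /eqP d1; move: dP; rewrite d1 => /gdist1 /andP[_]; rewrite !inE.
rewrite /mod_label; set N := label_period t m.
have N_gt0 : 0 < N%:Z by rewrite /N /label_period; lia.
have := divz_eq (2 * u) N%:Z; have := divz_eq (2 * v) N%:Z.
have := modz_ge0 (2 * u) (lt0r_neq0 N_gt0); have := ltz_pmod (2 * u) N_gt0.
have := modz_ge0 (2 * v) (lt0r_neq0 N_gt0); have := ltz_pmod (2 * v) N_gt0.
set i := (2 * u %% _)%Z; set j := (2 * v %% _)%Z.
set q := (2 * u %/ _)%Z; set r := (2 * v %/ _)%Z => _ j_ge0 _ i_ge0 Ev Eu.
(* With n = u - v, l = q - r and e = i - j this reads 2n = lN + e, and the labels differ by |e| m,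
   to be compared with 2m + 2 - d. *)
have En : 2 * (u - v) = (q - r) * N%:Z + (i - j) by lia.
rewrite !PoszM !gez0_abs // -mulrBl normrM [`|m%:Z|]gtr0_norm; last by lia.
have n_neq0 : u - v != 0 by apply/eqP; lia.
move: (u - v) (q - r) (i - j) En le_d d_neq1 n_neq0 => n l e En le_d d_neq1 n_neq0.
have far (a : nat) : (a * t < `|n|)%N -> (a < d)%N.
  by move=> lt_an; have := leq_trans lt_an le_d; rewrite ltn_mul2r => /andP[].
have N_le_mul (z : int) : z != 0 -> N%:Z <= `|z * N%:Z|.
  by move=> z_neq0; rewrite normrM [`|N%:Z|]gtr0_norm // ler_pMl //; lia.
(* As N is odd, l and e have the same parity. *)
have even_l : ~~ odd `|e| -> exists l', l = 2 * l'.
  by exists (l %/ 2)%Z; rewrite /N /label_period in En; lia.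
have N_def : N = (2 * (m.+1 * t) + 3)%N by [].
have [e0|e1|e2|e3] : [\/ `|e|%N = 0%N, `|e|%N = 1%N, `|e|%N = 2%N | (2 < `|e|)%N].
  by case: `|e|%N => [|[|[|?]]]; constructor.
(* Equal labels: n is a nonzero multiple of N, so |n| > 2(m + 1)t and d > 2m + 2. *)
- have [|l' El] := even_l; first by rewrite e0.
  have := N_le_mul l'; have := far (2 * m.+1)%N; rewrite -mulnA El in En *.
  have [l'0|_] := eqVneq l' 0; first by rewrite l'0 in En; lia.
  by lia.
(* Here l is odd, so 2|n| >= N - 1 > 2(m + 1)t and d >= m + 2. *)
- have := N_le_mul l; have := far m.+1.
  have [l0|_] := eqVneq l 0; first by rewrite l0 in En; lia.
  have -> : `|e| * m%:Z = m%:Z by rewrite -abszE e1 mul1r.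
  by lia.
(* Nonadjacency is enough: either |n| = 1 < t - 1, or |n| >= N - 1 > t. *)
- suff d_gt1 : (1 < d)%N.
    have -> : `|e| * m%:Z = 2 * m%:Z by rewrite -abszE e2.
    by lia.
  have [|l' El] := even_l; first by rewrite e2.
  rewrite El in En.
  have [l'0|l'_neq0] := eqVneq l' 0; first by rewrite l'0 in En; lia.
  have le_N := N_le_mul l' l'_neq0.
  have le_t : (t <= m.+1 * t)%N by rewrite leq_pmull.
  by apply: far; rewrite mul1n; lia.
(* Even adjacent vertices only require 2m + 1 <= 3m. *)
- have : 3 * m%:Z <= `|e| * m%:Z by rewrite ler_wpM2r //; lia.
  by lia.
Qed.

Theorem theorem6 (t k : nat) (ht : (2 < t)%N) (hk : (3 <= k)%N)
    (hodd : odd k) :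
  exists n : nat,
    is_rl (distance_graph [:: (t - 1)%N; t]) k n /\
    (n%:R : rat) <= t%:R / 2%:R * k%:R ^+ 2 + k%:R - (t%:R + 2%:R) / 2%:R.
Proof.
have [m Ek] : exists m, k = (2 * m + 1)%N by exists k./2; lia.
have m_gt0 : (0 < m)%N by lia.
have [n [nP le_n]] := is_rl_le (mod_label_radio ht m_gt0) (mod_label_span t m).
exists n; rewrite Ek; split=> //.
have: (n%:R : rat) <= (((2 * (m.+1 * t) + 2) * m)%N)%:R.
  by rewrite ler_nat; apply: leq_trans le_n _; rewrite /label_period addn3 addn2.
(* At k = 2m + 1 the claimed bound equals m(N - 1) exactly. *)
rewrite !(natrM, natrD) -[m.+1%:R]natr1; lra.
Qed.
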